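(* Let $F$ be a field of characteristic zero, let $\lambda\in F$ be nonzero, and let $n\ge1$. Then $\mathrm{rb}_\lambda(t_n(F))=2n-1$.
   Context: $t_n(F)$ is the subalgebra of $M_n(F)$ consisting of the (not strictly) upper-triangular $n\times n$ matrices. For an algebra $A$ over $F$ and $\lambda\in F$, a linear operator $R\colon A\to A$ is a Rota--Baxter operator of weight $\lambda$ if $R(x)R(y)=R(R(x)y+xR(y)+\lambda xy)$ for all $x,y\in A$. The Rota--Baxter $\lambda$-index of $A$ is $$\mathrm{rb}_\lambda(A)=\min\{m\in\mathbb N\mid \text{for every Rota--Baxter operator } R \text{ of weight }\lambda\text{ on }A\text{ there exists } 0\le k\le m \text{ with } R^k(R+\lambda\,\mathrm{id})^{m-k}=0\},$$ and $\mathrm{rb}_\lambda(A)=\infty$ if no such $m$ exists. *)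

(* Defs.v *)
From HB Require Import structures.
From mathcomp Require Import all_boot all_order all_algebra.
From mathcomp Require Import boolp.
Set Implicit Arguments.
Unset Strict Implicit.
Unset Printing Implicit Defensive.

Import GRing.Theory.
Local Open Scope ring_scope.

Section RotaBaxter.
Variables (F : fieldType) (A : algType F) (lambda : F).

Definition rota_baxter (R : {linear A -> A}) : Prop :=
  forall x y : A, R x * R y = R (R x * y + x * R y + lambda *: (x * y)).

Definition rb_bound (m : nat) : Prop :=
  forall R : {linear A -> A}, rota_baxter R ->
    exists2 k : nat, (k <= m)%N &
      forall x : A,
        iter k R (iter (m - k) (fun y => R y + lambda *: y) x) = 0.

(* [None] stands for infinity. *)
Definition rb_index : option nat :=
  match pselect (exists m, `[< rb_bound m >]) with
  | left exm => Some (ex_minn exm)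
  | right _ => None
  end.

Lemma rb_index_SomeP (m : nat) :
  rb_index = Some m <->
  rb_bound m /\ (forall p : nat, rb_bound p -> (m <= p)%N).
Proof.
rewrite /rb_index; case: pselect => [exm | nex]; split.
- case=> <-; case: ex_minnP => p /asboolP bp minp.
  by split=> // q bq; apply/minp/asboolP.
- case=> bm minm; congr Some; case: ex_minnP => p /asboolP bp minp.
  by apply/eqP; rewrite eqn_leq minm // minp //; apply/asboolP.
- by [].
- by case=> bm _; case: nex; exists m; apply/asboolP.
Qed.

Lemma rb_index_NoneP : rb_index = None <-> (forall m : nat, ~ rb_bound m).
Proof.
rewrite /rb_index; case: pselect => [[m bm] | nex]; split=> //.
- by move/(_ m); case; apply/asboolP.
- by move=> _ m bm; apply: nex; exists m; apply/asboolP.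
Qed.

End RotaBaxter.

Section UpperTriangular.
Variable F : fieldType.

(* [is_trig_mx] means lower triangular, hence the transpose. *)
Definition is_utmx n : {pred 'M[F]_n} := fun A => is_trig_mx A^T.

Lemma is_utmxP n (A : 'M[F]_n) :
  reflect (forall i j : 'I_n, (j < i)%N -> A i j = 0) (A \in @is_utmx n).
Proof.
by apply: (iffP is_trig_mxP) => utA i j ltij; have := utA j i ltij; rewrite mxE.
Qed.

Lemma is_utmx_subalg n : subalg_closed (@is_utmx n.+1).
Proof.
split.
- by apply/is_utmxP=> i j ltji; rewrite mxE -val_eqE gtn_eqF.
- move=> a A B /is_utmxP utA /is_utmxP utB; apply/is_utmxP=> i j ltji.
  by rewrite !mxE utA ?utB // mulr0 addr0.
- move=> A B /is_utmxP utA /is_utmxP utB; apply/is_utmxP=> i j ltji.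
  rewrite mxE big1 // => k _; have [ltki | leik] := ltnP k i.
    by rewrite utA ?mul0r.
  by rewrite utB ?mulr0 // (leq_trans ltji).
Qed.

HB.instance Definition _ n :=
  GRing.isSubalgClosed.Build F 'M[F]_n.+1 (@is_utmx n.+1) (@is_utmx_subalg n).

Record utmx n := Utmx { utmx_val :> 'M[F]_n; _ : utmx_val \in @is_utmx n }.

HB.instance Definition _ n := [isSub for @utmx_val n].
HB.instance Definition _ n := [Choice of utmx n by <:].
(* As for ['M[F]_n], the algebra structure requires a positive size. *)
HB.instance Definition _ n :=
  [SubChoice_isSubAlgebra of utmx n.+1 by <:].

End UpperTriangular.

(* Main.v *)
From HB Require Import structures.
Require Import Defs.
From mathcomp Require Import all_boot all_order all_algebra.
From mathcomp Require Import separable.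
From mathcomp Require Import boolp.
Set Implicit Arguments.
Unset Strict Implicit.
Unset Printing Implicit Defensive.
Import GRing.Theory.
Local Open Scope ring_scope.

(* Rescaling reduces to weight 1. Put [a = R 1], [s = R (R + 1)], and let [l],
   [r] be the left and right multiplications by [a]; the Rota-Baxter identity
   gives [l R - R l = r R - R r = s], which commutes with [R]. Thus the
   derivation [X |-> X R - R X] kills [s] and sends [l] and [r] to [s], so
   applying it [d] times to [p(l) = 0] with [deg p = d] gives [d! s^d = 0].
   By Cayley-Hamilton [s^N = 0], where [N] is the size of the matrices; applying
   the derivation [N - 1] times to [chi(l) - chi(r)], which is divisible by
   [l - r], also shows that [s^(N-1)] kills all commutators [a x - x a].

   If [a] is a root of a nonzero polynomial of degree less than [N], then
   [s^(N-1) = 0]. Otherwise, since [R^i (R + 1)^j 1] is the binomial coefficient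
   [(a + j) choose (i + j)] and [s^N 1 = 0], [a] is killed by a polynomial with
   simple roots, so its diagonal entries are distinct. Hence every strictly
   upper triangular matrix is a commutator with [a], every matrix is a
   polynomial in [a] modulo those, and [s^(N-1)] is determined by its values on
   [F[a]]. As [R] acts on [F[a]] with cyclic vector [1] and minimal polynomial
   of degree [N] dividing [X^N (X + 1)^N], some [R^k (R + 1)^(N-k)] vanishes on
   [F[a]], and one of [R^N (R + 1)^(N-1)], [R^(N-1) (R + 1)^N] is zero.

   The bound is attained by an operator that sums along the diagonals: with
   [sigma] the shift [e_ij |-> e_(i+1)(j+1)], it is [sigma / (1 - sigma)] on
   diagonal matrices and [- 1 / (1 - sigma^T)] on strictly upper triangular
   ones. *)

(** * The algebra of endomorphisms *)

Section Endomorphisms.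
Variables (F : fieldType) (A : algType F).

(** The boolean form of linearity makes [endo] a subtype, so pointwise equal endomorphisms are
    equal. With composition as product, [R], the multiplications and polynomials in them live in one
    [F]-algebra. *)
Record endo := Endo { endo_fun :> A -> A; _ : `[< linear endo_fun >] }.

HB.instance Definition _ := [isSub for endo_fun].
HB.instance Definition _ := [Choice of endo by <:].

Implicit Types f g h : endo.

Lemma endo_linear f : linear f.
Proof. by case: f => f /= /asboolP. Qed.

HB.instance Definition _ f :=
  GRing.isLinear.Build F A A *:%R (endo_fun f) (endo_linear f).

Lemma endoP f g : f =1 g <-> f = g.
Proof. by split=> [fg | ->//]; apply: val_inj; apply: funext. Qed.

Definition endo_of (f : {linear A -> A}) : endo :=
  Endo (asboolT (linearP f)).

Definition endo_zero := endo_of \0.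
Definition endo_one := endo_of idfun.
Definition endo_opp f := endo_of (\- f).
Definition endo_add f g := endo_of (f \+ g).
Definition endo_mul f g := endo_of (f \o g).
Definition endo_scale (c : F) f := endo_of (c \*: f).

Fact endo_addA : associative endo_add.
Proof. by move=> f g h; apply/endoP => x /=; rewrite addrA. Qed.
Fact endo_addC : commutative endo_add.
Proof. by move=> f g; apply/endoP => x /=; rewrite addrC. Qed.
Fact endo_add0 : left_id endo_zero endo_add.
Proof. by move=> f; apply/endoP => x /=; rewrite add0r. Qed.
Fact endo_addN : left_inverse endo_zero endo_opp endo_add.
Proof. by move=> f; apply/endoP => x /=; rewrite addNr. Qed.

HB.instance Definition _ :=
  GRing.isZmodule.Build endo endo_addA endo_addC endo_add0 endo_addN.

Fact endo_mulA : associative endo_mul.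
Proof. by move=> f g h; apply/endoP. Qed.
Fact endo_mul1 : left_id endo_one endo_mul.
Proof. by move=> f; apply/endoP. Qed.
Fact endo_1mul : right_id endo_one endo_mul.
Proof. by move=> f; apply/endoP. Qed.
Fact endo_mulDl : left_distributive endo_mul endo_add.
Proof. by move=> f g h; apply/endoP. Qed.
Fact endo_mulDr : right_distributive endo_mul endo_add.
Proof. by move=> f g h; apply/endoP => x /=; rewrite linearD. Qed.
Fact endo_oner_neq0 : endo_one != 0.
Proof.
apply/eqP => /endoP/(_ 1) /= /eqP; apply/negP; exact: oner_neq0.
Qed.

HB.instance Definition _ :=
  GRing.Zmodule_isNzRing.Build endo endo_mulA endo_mul1 endo_1mul
    endo_mulDl endo_mulDr endo_oner_neq0.

Fact endo_scaleA a b f : endo_scale a (endo_scale b f) = endo_scale (a * b) f.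
Proof. by apply/endoP => x /=; rewrite scalerA. Qed.
Fact endo_scale1 : left_id 1 endo_scale.
Proof. by move=> f; apply/endoP => x /=; rewrite scale1r. Qed.
Fact endo_scaleDr : right_distributive endo_scale +%R.
Proof. by move=> c f g; apply/endoP => x /=; rewrite scalerDr. Qed.
Fact endo_scaleDl f : {morph endo_scale^~ f : a b / a + b}.
Proof. by move=> a b; apply/endoP => x /=; rewrite scalerDl. Qed.

HB.instance Definition _ :=
  GRing.Zmodule_isLmodule.Build F endo endo_scaleA endo_scale1
    endo_scaleDr endo_scaleDl.

Fact endo_scaleAl (c : F) f g : c *: (f * g) = (c *: f) * g.
Proof. by apply/endoP. Qed.
HB.instance Definition _ := GRing.Lmodule_isLalgebra.Build F endo endo_scaleAl.

Fact endo_scaleAr (c : F) f g : c *: (f * g) = f * (c *: g).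
Proof. by apply/endoP => x /=; rewrite linearZ. Qed.
HB.instance Definition _ := GRing.Lalgebra_isAlgebra.Build F endo endo_scaleAr.

Lemma endo0E x : (0 : endo) x = 0. Proof. by []. Qed.
Lemma endo1E x : (1 : endo) x = x. Proof. by []. Qed.
Lemma endoDE f g x : (f + g) x = f x + g x. Proof. by []. Qed.
Lemma endoNE f x : (- f) x = - f x. Proof. by []. Qed.
Lemma endoME f g x : (f * g) x = f (g x). Proof. by []. Qed.
Lemma endoZE c f x : (c *: f) x = c *: f x. Proof. by []. Qed.
Definition endoE := (endo0E, endo1E, endoDE, endoNE, endoME, endoZE).

Lemma endoXE f k x : (f ^+ k) x = iter k f x.
Proof. by elim: k => //= k IH; rewrite exprS endoME IH. Qed.

End Endomorphisms.

(** * The derivation [X |-> X R - R X] *)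

Lemma horner_algZ (F : fieldType) (B : algType F) (x : B) c (p : {poly F}) :
  horner_alg x (c *: p) = c *: horner_alg x p.
Proof. by rewrite linearZ /= mulr_algl. Qed.

Lemma horner_algE (F : fieldType) (B : algType F) (x : B) (p : {poly F}) :
  horner_alg x p = \sum_(i < size p) p`_i *: x ^+ i.
Proof.
rewrite -[p in LHS]coefK poly_def raddf_sum /=; apply: eq_bigr => i _.
by rewrite horner_algZ rmorphXn /= horner_algX.
Qed.

Section Commutator.
Variables (F : fieldType) (B : algType F) (R : B).

Definition comm_with (X : B) := X * R - R * X.
Local Notation delta := comm_with.

Lemma comm_with_linear : linear delta.
Proof.
by move=> c X Y; rewrite /delta mulrDl mulrDr -scalerAl -scalerAr scalerBr
  opprD addrACA.
Qed.
HB.instance Definition _ :=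
  GRing.isLinear.Build F B B *:%R delta comm_with_linear.

Lemma comm_withM X Y : delta (X * Y) = delta X * Y + X * delta Y.
Proof.
by rewrite /delta mulrBl mulrBr !mulrA [RHS]addrC addrA subrK.
Qed.

Lemma iter_comm_with_linear k : linear (iter k delta).
Proof.
by elim: k => [|k IH] c X Y; rewrite // !iterS IH linearP.
Qed.
HB.instance Definition _ k :=
  GRing.isLinear.Build F B B *:%R (iter k delta) (iter_comm_with_linear k).

Variable s : B.
Hypothesis delta_s : delta s = 0.

(** Leibniz rule: since [delta X = s] and [delta s = 0], only two terms survive. *)
Lemma iter_comm_withMl X Y k : delta X = s ->
  iter k.+1 delta (X * Y) =
    X * iter k.+1 delta Y + (s * iter k delta Y) *+ k.+1.
Proof.
move=> dX; elim: k => [|k IH]; first by rewrite /= comm_withM dX addrC.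
rewrite iterS IH linearD linearMn /= !comm_withM dX delta_s mul0r add0r.
by rewrite [in RHS]mulrS addrCA addrA.
Qed.

(** Models a monomial of degree [m] under repeated differentiation, [s] being the derivative of the
    variable. *)
Definition has_order m X :=
  iter m delta X = s ^+ m *+ m`! /\ iter m.+1 delta X = 0.

Lemma has_order1 : has_order 0 1.
Proof. by split; rewrite //= /comm_with mul1r mulr1 subrr. Qed.

Lemma has_orderMl m X Y : delta X = s -> has_order m Y ->
  has_order m.+1 (X * Y).
Proof.
move=> dX [Ym YSm]; split.
  rewrite iter_comm_withMl // YSm mulr0 add0r Ym exprS -mulrnAr.
  by rewrite -mulrnA mulnC factS mulrnAr.
rewrite iter_comm_withMl // YSm mulr0 mul0rn addr0.
by rewrite iterS YSm linear0 mulr0.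
Qed.

Lemma has_orderX m i X Y : delta X = s -> has_order m Y ->
  has_order (i + m) (X ^+ i * Y).
Proof.
move=> dX oY; elim: i => [|i IH]; first by rewrite mul1r.
by rewrite exprS -mulrA addSn; apply: has_orderMl.
Qed.

Lemma has_order_eq0 m k X : has_order m X -> (m < k)%N -> iter k delta X = 0.
Proof.
move=> [_ Xm0] /subnK <-; rewrite iterD Xm0; apply: linear0.
Qed.

Lemma iter_comm_with_horner (p : {poly F}) X d : delta X = s ->
  size p = d.+1 ->
  iter d delta (horner_alg X p) = (lead_coef p * d`!%:R) *: s ^+ d.
Proof.
move=> dX sp; have oX i : has_order i (X ^+ i).
  by rewrite -[i]addn0 -[_ ^+ _]mulr1 addn0 -[i in has_order i]addn0;
     apply: has_orderX => //; apply: has_order1.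
rewrite horner_algE sp raddf_sum /= big_ord_recr big1 /= => [|i _]; last first.
  by rewrite linearZ /= (has_order_eq0 (oX i)) ?scaler0.
rewrite add0r linearZ /= (oX d).1.
by rewrite lead_coefE sp -scaler_nat scalerA.
Qed.

Hypothesis charF0 : [pchar F] =i pred0.

(** Applying [delta] [d] times to [p(X)] leaves the leading coefficient times [d! s^d]; in
    characteristic zero that scalar is invertible. *)
Lemma horner_alg_eq0_nilpotent (p : {poly F}) X d : delta X = s ->
  size p = d.+1 -> horner_alg X p = 0 -> s ^+ d = 0.
Proof.
move=> dX sp pX0; have := iter_comm_with_horner dX sp.
rewrite pX0 linear0 => /esym/eqP; rewrite scaler_eq0 mulf_eq0.
rewrite ((pcharf0P F).1 charF0) // (gtn_eqF (fact_gt0 d)) orbF lead_coef_eq0.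
rewrite -size_poly_eq0.
by rewrite sp => /eqP.
Qed.

(* Applying [delta] repeatedly to [p(X) - p(Y) = (X - Y) q(X, Y)], where [q] has
   degree [d - 1]. *)
Lemma horner_alg_eq0_mul_nilpotent (p : {poly F}) X Y d :
    delta X = s -> delta Y = s -> GRing.comm X Y ->
    size p = d.+2 -> horner_alg X p = 0 -> horner_alg Y p = 0 ->
  (X - Y) * s ^+ d = 0.
Proof.
move=> dX dY cXY sp pX0 pY0; set c := X - Y.
have dc : delta c = 0 by rewrite linearB /= dX dY subrr.
have dcM k Z : iter k delta (c * Z) = c * iter k delta Z.
  by elim: k => //= k ->; rewrite comm_withM dc mul0r add0r.
have oXY i j : has_order (i + j) (X ^+ i * Y ^+ j).
  apply: has_orderX => //; rewrite -[_ ^+ j]mulr1 -[j in has_order j]addn0.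
  by apply: has_orderX => //; apply: has_order1.
pose q k := \sum_(i < k) X ^+ (k.-1 - i) * Y ^+ i.
have qE k : X ^+ k - Y ^+ k = c * q k by rewrite subrXX_comm.
have : iter d delta (horner_alg X p - horner_alg Y p) = 0.
  by rewrite pX0 pY0 subrr linear0.
rewrite !horner_algE sp -sumrB.
rewrite (eq_bigr (fun i : 'I_d.+2 => c * (p`_i *: q i))); last first.
  by move=> i _; rewrite -scalerBr qE scalerAr.
rewrite -mulr_sumr dcM raddf_sum /= big_ord_recr /= big1 => [|i _]; last first.
  rewrite linearZ /= raddf_sum /= big1 ?scaler0 // => j _.
  apply: (has_order_eq0 (oXY _ _)).
  by case: i j => -[|i] /= lt_i_d j; [case: j | rewrite subnK // -ltnS].
rewrite add0r linearZ /= raddf_sum /=.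
(* The top quotient has [d + 1] monomials, all of degree [d], and each contributes [d! s^d]. *)
rewrite (eq_bigr (fun=> s ^+ d *+ d`!)) => [|i _]; last first.
  by have [] := oXY (d - i)%N i; rewrite subnK // -ltnS.
rewrite sumr_const card_ord -mulrnA -scaler_nat scalerA -scalerAr => /eqP.
rewrite scaler_eq0 mulf_eq0 ((pcharf0P F).1 charF0) // muln_eq0.
rewrite (gtn_eqF (fact_gt0 d)) /= orbF => /orP[|/eqP//].
have -> : p`_d.+1 = lead_coef p by rewrite lead_coefE sp.
by rewrite lead_coef_eq0 -size_poly_eq0 sp.
Qed.

End Commutator.

(** * Rota-Baxter operators of weight 1 *)

Section WeightOne.
Variables (F : fieldType) (A : algType F).

Definition lmul (a : A) : endo A := endo_of (a \*o idfun).
Definition rmul (a : A) : endo A := endo_of (a \o* idfun).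

Lemma lmul_horner (a : A) (p : {poly F}) :
  horner_alg (lmul a) p = lmul (horner_alg a p).
Proof.
apply/endoP => x; rewrite /= !horner_algE.
elim/big_rec2: _ => [|i y f _ IH]; first by rewrite endo0E mul0r.
rewrite endoDE endoZE {}IH mulrDl -scalerAl; congr (_ *: _ + _).
by elim: (nat_of_ord i) => [|k IH]; rewrite ?mul1r // !exprS -mulrA -IH.
Qed.

(** Right multiplication reverses products, which is harmless for powers of a single element. *)
Lemma rmul_horner (a : A) (p : {poly F}) :
  horner_alg (rmul a) p = rmul (horner_alg a p).
Proof.
apply/endoP => x; rewrite /= !horner_algE.
elim/big_rec2: _ => [|i y f _ IH]; first by rewrite endo0E mulr0.
rewrite endoDE endoZE {}IH mulrDr -scalerAr; congr (_ *: _ + _).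
by elim: (nat_of_ord i) => [|k IH]; rewrite ?mulr1 // exprS exprSr mulrA -IH.
Qed.

Lemma comm_lmul_rmul (a b : A) : GRing.comm (lmul a) (rmul b).
Proof. by apply/endoP => x; rewrite !endoME /= mulrA. Qed.

Hypothesis charF0 : [pchar F] =i pred0.
Variable R : endo A.
Hypothesis rbR : forall x y, R x * R y = R (R x * y + x * R y + x * y).

Let a := R 1.
Let s := R * (R + 1).

(** The Rota-Baxter identity for the pair [1], [x] reads [a (R x) = R (a x) + R (R x + x)]. *)
Lemma comm_with_lmul : comm_with R (lmul a) = s.
Proof.
apply/endoP => x; rewrite /comm_with !endoE /= rbR !mul1r !linearD /=.
by rewrite -[X in X - _]addrA [LHS]addrC addKr.
Qed.

Lemma comm_with_rmul : comm_with R (rmul a) = s.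
Proof.
apply/endoP => x; rewrite /comm_with !endoE /= rbR !mulr1 !linearD /=.
by rewrite [X in X - _]addrAC addrK.
Qed.

Lemma comm_with_s : comm_with R s = 0.
Proof.
by rewrite /comm_with /s mulrDr mulr1 mulrDl mulrDr mulrA subrr.
Qed.

(** Equivalently [(a - i) w = (i + j + 1) R w], hence [(a + j + 1) w = (i + j + 1) (R + 1) w]: these
    are the recurrences of binomial coefficients. *)
Lemma mul_iterR1 (i j : nat) (w := (R ^+ i * (R + 1) ^+ j) 1) :
  a * w = R w *+ (i + j).+1 + w *+ i.
Proof.
have aR y : a * R y = R (a * y) + R (R y) + R y.
  by rewrite rbR !mul1r !linearD.
rewrite /w {w}; elim: i => [|i IH]; last first.
  rewrite exprS -mulrA endoME aR IH linearD !linearMn /= addSn.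
  by rewrite [in RHS]mulrSr -!addrA; congr (_ + _); rewrite addrCA -mulrSr.
elim: j => [|j IH].
  by rewrite mul1r endo1E mulr1 mulr0n addr0.
rewrite mul1r mulr0n !addr0 in IH *.
rewrite exprS endoME; set w := endo_fun _ 1 in IH *.
rewrite !endoE mulrDr aR IH.
rewrite linearMn linearD /= -mulrSr -addrA -mulrS mulrnDl.
by [].
Qed.

Definition binomial_roots (i j : nat) : seq F :=
  [seq k%:R | k <- iota 0 i] ++ [seq - k.+1%:R | k <- iota 0 j].

(** The numerator of [(X + j) choose (i + j)], whose roots are the consecutive integers from [-j] to
    [i - 1]. *)
Definition rising_falling (i j : nat) : {poly F} :=
  \prod_(z <- binomial_roots i j) ('X - z%:P).

Lemma rising_falling0 : rising_falling 0 0 = 1.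
Proof. by rewrite /rising_falling big_nil. Qed.

Lemma rising_fallingSl i j :
  rising_falling i.+1 j = ('X - i%:R%:P) * rising_falling i j.
Proof.
rewrite /rising_falling /binomial_roots -addn1 iotaD map_cat -catA !big_cat /=.
by rewrite big_seq1 mulrCA.
Qed.

Lemma rising_fallingSr i j :
  rising_falling i j.+1 = ('X + j.+1%:R%:P) * rising_falling i j.
Proof.
rewrite /rising_falling /binomial_roots -[in LHS]addn1 iotaD map_cat catA.
by rewrite big_cat /= big_seq1 mulrC polyCN opprK add0n.
Qed.

Lemma size_rising_falling i j : size (rising_falling i j) = (i + j).+1.
Proof. by rewrite size_prod_XsubC size_cat !size_map !size_iota. Qed.

(** Distinct integers stay distinct in characteristic zero; this makes [rising_falling]
    separable. *)
Lemma uniq_binomial_roots i j : uniq (binomial_roots i j).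
Proof.
have natf_inj : injective (fun k => k%:R : F).
  move=> k m /eqP; wlog le_mk : k m / (m <= k)%N.
    by move=> IH; case/orP: (leq_total m k) => /IH // H; rewrite eq_sym => /H.
  rewrite -subr_eq0 -natrB // ((pcharf0P F).1 charF0) subn_eq0 => le_km.
  by apply/eqP; rewrite eqn_leq le_km.
rewrite cat_uniq !map_inj_uniq ?iota_uniq //=; last first.
  by move=> k m /oppr_inj/natf_inj [].
rewrite andbT -all_predC; apply/allP => _ /mapP [k _ ->]; apply/negP.
case/mapP => m _ /esym/eqP; rewrite -subr_eq0 opprK -natrD.
by rewrite ((pcharf0P F).1 charF0) addnS.
Qed.

(* With [a = R 1], [R ^ i (R + 1) ^ j 1] is the binomial coefficient
   [(a + j) choose (i + j)]. *)
Lemma iterR1 (i j : nat) :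
  (R ^+ i * (R + 1) ^+ j) 1 *+ (i + j)`! = horner_alg a (rising_falling i j).
Proof.
elim: i => [|i IH]; last first.
  rewrite exprS -mulrA endoME addSn factS mulrnA.
  have /eqP := mul_iterR1 i j; rewrite -subr_eq => /eqP <-.
  rewrite mulrnBl -[_ *+ i]mulr_natl -mulrnAr -mulrnAr -mulrBl IH.
  rewrite rising_fallingSl [RHS]rmorphM /= linearB /= horner_algX horner_algC.
  by rewrite scaler_nat.
elim: j => [|j IH]; first by rewrite rising_falling0 mul1r [RHS]rmorph1.
rewrite mul1r exprS endoME factS mulrnA.
have /eqP := mul_iterR1 0 j; rewrite mulr0n addr0 mul1r => /eqP E.
rewrite !endoE mulrnDl -E -[_ *+ j.+1]mulr_natl -mulrDl -mulrnAr.
rewrite mul1r in IH; rewrite IH.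
rewrite rising_fallingSr [RHS]rmorphM /= linearD /= horner_algX horner_algC.
by rewrite scaler_nat.
Qed.

End WeightOne.

(** Once the full power of [X - x] is split off [p], the cofactor is coprime to [X - x] and so
    divides the power of [X - y]. *)
Lemma dvdp_mul_exp_XsubC (F : fieldType) (x y : F) (m n : nat) (p : {poly F}) :
    x != y -> p %| ('X - x%:P) ^+ m * ('X - y%:P) ^+ n ->
  exists k j, [/\ (k <= m)%N, (j <= n)%N &
    p %= ('X - x%:P) ^+ k * ('X - y%:P) ^+ j].
Proof.
move=> xy pdvd.
have nz : ('X - x%:P) ^+ m * ('X - y%:P) ^+ n != 0.
  by rewrite mulf_neq0 // expf_neq0 // polyXsubC_eq0.
have p0 : p != 0 by apply: contraTneq pdvd => ->; rewrite dvd0p.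
have [k [q qx pE]] := multiplicity_XsubC p x.
rewrite p0 /= in qx.
have cqx i : coprimep q (('X - x%:P) ^+ i).
  by apply: coprimep_expr; rewrite coprimep_XsubC.
have qy : q %| ('X - y%:P) ^+ n.
  rewrite -(Gauss_dvdpr _ (cqx m)); apply: dvdp_trans pdvd.
  by rewrite pE dvdp_mulr.
have le_km : (k <= m)%N.
  have : ('X - x%:P) ^+ k %| ('X - x%:P) ^+ m.
    rewrite -(@Gauss_dvdpl _ _ (('X - y%:P) ^+ n)).
      by apply: dvdp_trans pdvd; rewrite pE dvdp_mull.
    apply: coprimep_expl; apply: coprimep_expr.
    by rewrite coprimep_XsubC root_XsubC eq_sym.
  by rewrite dvdp_Pexp2l // size_XsubC.
have /dvdp_exp_XsubCP[j le_jn qE] := qy.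
exists k, j; split=> //; rewrite pE mulrC.
exact: eqp_mull.
Qed.

(** * The action of [R] on [F[a]], with cyclic vector [1] *)

Section CyclicVector.
Variables (F : fieldType) (A : algType F).
Hypothesis charF0 : [pchar F] =i pred0.
Variable R : endo A.
Hypothesis rbR : forall x y, R x * R y = R (R x * y + x * R y + x * y).

Let a := R 1.

Definition binomial_poly (i : nat) : {poly F} :=
  i`!%:R^-1 *: rising_falling F i 0.

Lemma fact_neq0 i : i`!%:R != 0 :> F.
Proof. by rewrite ((pcharf0P F).1 charF0) -lt0n fact_gt0. Qed.

Lemma size_binomial_poly i : size (binomial_poly i) = i.+1.
Proof.
by rewrite size_scale ?invr_eq0 ?fact_neq0 // size_rising_falling addn0.
Qed.

Lemma lead_coef_binomial_poly i : lead_coef (binomial_poly i) = i`!%:R^-1.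
Proof. by rewrite lead_coefZ lead_coef_prod_XsubC mulr1. Qed.

Lemma iterR1_binomial_poly i : (R ^+ i) 1 = horner_alg a (binomial_poly i).
Proof.
rewrite horner_algZ -(iterR1 rbR i 0) expr0 mulr1 addn0 -scaler_nat scalerA.
by rewrite mulVf ?fact_neq0 // scale1r.
Qed.

(** Replaces the monomials of [p] by binomial polynomials, which turns [p(R) 1] into a polynomial in
    [a] of the same degree. *)
Definition newton_poly (p : {poly F}) : {poly F} :=
  \sum_(i < size p) p`_i *: binomial_poly i.

Lemma horner_algR1 p : horner_alg R p 1 = horner_alg a (newton_poly p).
Proof.
rewrite (horner_algE R p) /newton_poly raddf_sum /=.
elim/big_rec2: _ => [|i y f _ IH]; first by [].
by rewrite endoDE endoZE {}IH iterR1_binomial_poly horner_algZ.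
Qed.

Lemma size_newton_poly p : size (newton_poly p) = size p.
Proof.
have [->|p0] := eqVneq p 0.
  by rewrite /newton_poly size_poly0 big_ord0 size_poly0.
have szp : size p = (size p).-1.+1 by rewrite prednK // size_poly_gt0.
rewrite /newton_poly szp big_ord_recr /= addrC size_polyDl size_scale;
  rewrite ?size_binomial_poly // -?lead_coefE ?lead_coef_eq0 //.
rewrite ltnS; apply: (leq_trans (size_sum _ _ _)); apply/bigmax_leqP => i _.
by apply: (leq_trans (size_scale_leq _ _)); rewrite size_binomial_poly.
Qed.

Lemma horner_algR1_surj (q : {poly F}) :
  exists2 p : {poly F}, size p = size q & horner_alg R p 1 = horner_alg a q.
Proof.
have [m] := ubnP (size q); elim: m q => // m IH q.
have [-> _|q0] := eqVneq q 0; first by exists 0; rewrite // !rmorph0.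
set d := (size q).-1.
have szq : size q = d.+1 by rewrite prednK // size_poly_gt0.
rewrite szq ltnS => le_d_m.
(* As [binomial_poly d] has leading coefficient [1 / d!], this [c] cancels the top term of [q]. *)
set c := lead_coef q * d`!%:R.
have c0 : c != 0 by rewrite mulf_neq0 ?fact_neq0 ?lead_coef_eq0.
have szq' : (size (q - c *: binomial_poly d)%R < d.+1)%N.
  have szB : size (binomial_poly d) = d.+1 by rewrite size_binomial_poly.
  rewrite ltnS; apply/leq_sizeP => j; rewrite leq_eqVlt => /predU1P[<-|lt_dj].
    have := lead_coef_binomial_poly d; rewrite lead_coefE szB /= => bd.
    by rewrite coefB coefZ bd /c mulfK ?fact_neq0 // lead_coefE subrr.
  by rewrite coefB coefZ !nth_default ?mulr0 ?subr0 ?szB ?szq.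
have [p szp hp] := IH _ (leq_trans szq' le_d_m).
exists (c *: 'X^d + p).
  by rewrite size_polyDl ?size_scale ?size_polyXn // szp.
rewrite rmorphD endoDE /= hp horner_algZ endoZE rmorphXn /= horner_algX.
rewrite iterR1_binomial_poly.
by rewrite rmorphB /= (horner_algZ a c) [LHS]addrC subrK.
Qed.

Lemma nilpotentR (d : nat) (p : {poly F}) :
  size p = d.+1 -> horner_alg a p = 0 -> (R * (R + 1)) ^+ d = 0.
Proof.
move=> szp pa0.
have sl := comm_with_lmul rbR.
apply: (horner_alg_eq0_nilpotent (comm_with_s R) charF0 sl szp).
by rewrite lmul_horner pa0; apply/endoP => x /=; rewrite mul0r.
Qed.

Lemma nilpotentR_comm (d : nat) (p : {poly F}) x :
    size p = d.+2 -> horner_alg a p = 0 ->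
  ((R * (R + 1)) ^+ d) (a * x - x * a) = 0.
Proof.
move=> szp pa0; set s := R * (R + 1).
have sl := comm_with_lmul rbR; have sr := comm_with_rmul rbR.
have c0 : (lmul a - rmul a) * s ^+ d = 0.
  apply: (horner_alg_eq0_mul_nilpotent (comm_with_s R) charF0 sl sr _ szp).
  - exact: comm_lmul_rmul.
  - by rewrite lmul_horner pa0; apply/endoP => y /=; rewrite mul0r.
  - by rewrite rmul_horner pa0; apply/endoP => y /=; rewrite mulr0.
(* Both multiplications have commutator [s] with [R], so their difference commutes with [R], and
   [s^d] can be applied last. *)
have cR : GRing.comm (lmul a - rmul a) R.
  apply/eqP; rewrite -subr_eq0; apply/eqP.
  rewrite -[LHS]/(comm_with R (lmul a - rmul a)) linearB /=.
  by rewrite sl sr subrr.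
have cs : GRing.comm (lmul a - rmul a) (s ^+ d).
  by apply/commrX/commrM => //; apply/commrD => //; apply: commr1.
by have /endoP/(_ x) := c0; rewrite cs.
Qed.

Lemma cyclic_annihilator (n : nat) (chi : {poly F}) :
    size chi = n.+1 -> horner_alg a chi = 0 ->
    (forall p : {poly F}, (size p <= n)%N -> horner_alg a p = 0 -> p = 0) ->
  exists k j, (k + j)%N = n /\
    forall q : {poly F}, (R ^+ k * (R + 1) ^+ j) (horner_alg a q) = 0.
Proof.
move=> szchi chia mina.
(* This [p], of degree [n], serves as the minimal polynomial of [R] at the vector [1]. *)
have [p szp pR1] := horner_algR1_surj chi; rewrite chia in pR1.
rewrite szchi in szp.
have hRM (q1 q2 : {poly F}) x :
    horner_alg R (q1 * q2) x = horner_alg R q1 (horner_alg R q2 x).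
  by rewrite rmorphM endoME.
have hRX k j : horner_alg R (('X - 0%:P) ^+ k * ('X - (-1)%:P) ^+ j) =
    R ^+ k * (R + 1) ^+ j.
  by rewrite polyC0 subr0 polyCN opprK rmorphM !rmorphXn rmorphD /=
    horner_algX rmorph1.
set w := ('X - 0%:P) ^+ n * ('X - (-1)%:P) ^+ n : {poly F}.
(* The remainder of [w] modulo [p] sends [1] to zero, so its Newton polynomial kills [a]; its degree
   is below [n], so it is zero. *)
have pw : p %| w.
  have wR : horner_alg R w = 0.
    rewrite hRX -exprMn_comm ?(nilpotentR szchi chia) //.
    by apply: commrD => //; apply: commr1.
  have : horner_alg R (w %% p) 1 = 0.
    have -> : w %% p = w - w %/ p * p.
      by rewrite [w in w - _](divp_eq w p) addrC addKr.
    by rewrite rmorphB endoDE endoNE /= (hRM (w %/ p)) pR1 wR linear0 subr0.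
  rewrite horner_algR1 => /mina; rewrite size_newton_poly -ltnS -szp.
  rewrite ltn_modpN0 -?size_poly_eq0 ?szp // => /(_ isT)/eqP.
  by rewrite -size_poly_eq0 size_newton_poly size_poly_eq0.
have neq01 : 0 != -1 :> F by rewrite eq_sym oppr_eq0 oner_eq0.
have [k [j [_ _ peq]]] := dvdp_mul_exp_XsubC neq01 pw.
exists k, j; split.
  have := eqp_size peq; rewrite szp size_mul ?expf_neq0 ?polyXsubC_eq0 //.
  by rewrite !size_exp_XsubC addnS addSn => -[].
(* Every [q(a)] is some [r(R) 1], and polynomials in [R] commute, so it suffices to kill [1]. *)
move=> q; have [r _ <-] := horner_algR1_surj q.
have [[c1 c2] /= /andP[c1_0 c2_0] E] := eqpP _ _ peq.
rewrite -endoME -hRX -hRM mulrC hRM.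
have : horner_alg R (c2 *: (('X - 0%:P) ^+ k * ('X - (-1)%:P) ^+ j)) 1 = 0.
  by rewrite -E horner_algZ endoZE pR1 scaler0.
rewrite horner_algZ endoZE => /eqP; rewrite scaler_eq0 (negPf c2_0) /=.
by move=> /eqP ->; rewrite linear0.
Qed.

End CyclicVector.

(** * Upper triangular matrices *)

Section Triangular.
Variables (F : fieldType) (n : nat).
Local Notation A := (utmx F n.+1).
Implicit Types (x y a : A).

Lemma utmxP x y : (forall i j, x i j = y i j) -> x = y.
Proof. by move=> xy; apply/val_inj/matrixP. Qed.

Lemma utmx_lt x (i j : 'I_n.+1) : (j < i)%N -> x i j = 0.
Proof. by case: x => M /= /is_utmxP; apply. Qed.

Lemma utmx0E i j : (0 : A) i j = 0.
Proof. by rewrite /= mxE. Qed.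
Lemma utmx1E i j : (1 : A) i j = (i == j)%:R.
Proof. by rewrite [utmx_val _]/= mxE. Qed.
Lemma utmxDE x y i j : (x + y) i j = x i j + y i j.
Proof. by rewrite /= mxE. Qed.
Lemma utmxNE x i j : (- x) i j = - x i j.
Proof. by rewrite /= mxE. Qed.
Lemma utmxZE c x i j : (c *: x) i j = c * x i j.
Proof. by rewrite /= mxE. Qed.
Lemma utmxME x y i j : (x * y) i j = \sum_k x i k * y k j.
Proof. by rewrite /= mxE. Qed.

Lemma utmx_horner x (p : {poly F}) :
  utmx_val (horner_alg x p) = horner_mx (utmx_val x) p.
Proof.
elim/poly_ind: p => [|p c IH]; first by rewrite !rmorph0.
rewrite rmorphD rmorphM /= rmorphD rmorphM /= !horner_algX horner_mx_X.
by rewrite !horner_algC horner_mx_C -IH -scalemx1.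
Qed.

Lemma utmx_char_poly x : char_poly (utmx_val x) = \prod_i ('X - (x i i)%:P).
Proof.
have utx : is_trig_mx (utmx_val x)^T by case: x.
transitivity (char_poly (utmx_val x)^T); last first.
  by rewrite char_poly_trig //; apply: eq_bigr => i _; rewrite mxE.
rewrite /char_poly -[LHS]det_tr /char_poly_mx linearB /= tr_scalar_mx.
by rewrite map_trmx.
Qed.

Lemma utmx_Cayley_Hamilton x : horner_alg x (\prod_i ('X - (x i i)%:P)) = 0.
Proof.
by apply: val_inj; rewrite /= utmx_horner -utmx_char_poly Cayley_Hamilton.
Qed.

Lemma utmx_diagM x y i : (x * y) i i = x i i * y i i.
Proof.
rewrite utmxME (bigD1 i) //= big1 ?addr0 // => k; rewrite neq_ltn.
by case/orP => ltk; rewrite (utmx_lt _ ltk) ?mul0r ?mulr0.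
Qed.

Lemma utmx_diag_horner x (p : {poly F}) i : (horner_alg x p) i i = p.[x i i].
Proof.
elim/poly_ind: p => [|p c IH]; first by rewrite rmorph0 horner0 utmx0E.
have -> : horner_alg x (p * 'X + c%:P) = horner_alg x p * x + c%:A.
  by rewrite rmorphD rmorphM /= horner_algX horner_algC.
by rewrite utmxDE utmx_diagM IH utmxZE utmx1E eqxx mulr1 hornerMXaddC.
Qed.

Variable a : A.
Hypothesis inj_a : injective (fun i => a i i).

(** Lagrange interpolation at the distinct nodes [a i i]: the diagonal of [p(a)] consists of the
    values of [p] there. *)
Lemma diag_interpolation x :
  exists p : {poly F}, forall i, (x - horner_alg a p) i i = 0.
Proof.
pose lag i : {poly F} := \prod_(j | j != i) ('X - (a j j)%:P).
have lag_neq0 i : (lag i).[a i i] != 0.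
  rewrite horner_prod; apply/prodf_neq0 => j ne_ji.
  by rewrite hornerXsubC subr_eq0 (inj_eq inj_a) eq_sym.
have lag_eq0 i j : j != i -> (lag i).[a j j] = 0.
  move=> ne_ji; rewrite horner_prod (bigD1 j) //= hornerXsubC subrr.
  by rewrite mul0r.
exists (\sum_i (x i i / (lag i).[a i i]) *: lag i) => i.
rewrite utmxDE utmxNE utmx_diag_horner horner_sum (bigD1 i) //= big1.
  by rewrite addr0 hornerZ divfK // subrr.
by move=> j ne_ji; rewrite hornerZ (lag_eq0 j i) 1?eq_sym // mulr0.
Qed.

(* Any matrix on the [d]-th superdiagonal and above is, modulo the next
   superdiagonals, a commutator [a y - y a]. *)
Lemma strict_commutator_kernel (V : zmodType) (U : {additive A -> V}) x :
    (forall y, U (a * y - y * a) = 0) -> (forall i, x i i = 0) -> U x = 0.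
Proof.
move=> Uc x0.
(* Here [m] bounds the number of superdiagonals, those of offset above [d], that may still be
   nonzero. *)
suff: forall m d x, (n <= m + d)%N ->
    (forall i j : 'I_n.+1, (j <= i + d)%N -> x i j = 0) -> U x = 0.
  move/(_ n 0%N x); apply; first by rewrite addn0.
  move=> i j; rewrite addn0 leq_eqVlt => /orP[/eqP/val_inj->|/utmx_lt] //.
elim=> [|m IH] d {x0}x le_n xd.
  rewrite (_ : x = 0) ?raddf0 //; apply: utmxP => i j; rewrite utmx0E xd //.
  by rewrite (leq_trans _ (leq_addl _ _)) // (leq_trans _ le_n) // -ltnS.
(* Solves [(a i i - a j j) * y i j = x i j]. On the diagonal the divisor is zero, but so is
   [x i i]. *)
pose Y := \matrix_(i, j) (x i j / (a i i - a j j)) : 'M[F]_n.+1.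
have utY : Y \in @is_utmx F n.+1.
  by apply/is_utmxP => i j ltji; rewrite mxE utmx_lt // mul0r.
pose y : A := Utmx utY.
have yd (i j : 'I_n.+1) : (j <= i + d)%N -> y i j = 0.
  by move=> le; rewrite mxE xd // mul0r.
have -> : U x = U (x - (a * y - y * a)) by rewrite raddfB Uc subr0.
apply: (IH d.+1) => [|i j]; first by rewrite addnS -addSn.
rewrite addnS leq_eqVlt ltnS => jd.
(* For [j <= i + d + 1], [y] vanishes below [(i, j)] in its column and to the left in its row, so
   only diagonal entries of [a] enter both products. *)
have lt_ij (k : 'I_n.+1) : (i < k)%N -> y k j = 0.
  move=> lt_ik; apply: yd; case/orP: jd => [/eqP->|le_j].
    by rewrite -addSn leq_add2r.
  by rewrite (leq_trans le_j) // leq_add2r ltnW.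
have lt_kj (k : 'I_n.+1) : (k < j)%N -> y i k = 0.
  move=> lt_kj; apply: yd; case/orP: jd => [/eqP jE|le_j].
    by rewrite -ltnS -jE.
  by rewrite (leq_trans (ltnW lt_kj)).
have ay : (a * y) i j = a i i * y i j.
  rewrite utmxME (bigD1 i) //= big1 ?addr0 // => k; rewrite neq_ltn.
  by case/orP => ltk; [rewrite utmx_lt // mul0r | rewrite lt_ij // mulr0].
have ya : (y * a) i j = y i j * a j j.
  rewrite utmxME (bigD1 j) //= big1 ?addr0 // => k; rewrite neq_ltn.
  by case/orP => ltk; [rewrite lt_kj // mul0r | rewrite utmx_lt // mulr0].
rewrite utmxDE utmxNE utmxDE utmxNE ay ya [_ * a j j]mulrC -mulrBl mxE.
have [eij|neij] := eqVneq i j.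
  by rewrite -eij xd ?leq_addr // mul0r mulr0 subrr.
by rewrite mulrCA divff ?mulr1 ?subrr // subr_eq0 (inj_eq inj_a).
Qed.

End Triangular.

(** * The upper bound in weight 1 *)

Section UpperBound.
Variables (F : fieldType) (n : nat).
Local Notation A := (utmx F n.+1).
Hypothesis charF0 : [pchar F] =i pred0.
Variable R : endo A.
Hypothesis rbR : forall x y, R x * R y = R (R x * y + x * R y + x * y).

Let a := R 1.
Let chi : {poly F} := \prod_i ('X - (a i i)%:P).

Lemma size_chi : size chi = n.+2.
Proof. by rewrite size_prod_XsubC /index_enum -enumT size_enum_ord. Qed.

Lemma chi_eq0 : horner_alg a chi = 0.
Proof. exact: utmx_Cayley_Hamilton. Qed.

Section Nonderogatory.
Hypothesis mina :
  forall p : {poly F}, (size p <= n.+1)%N -> horner_alg a p = 0 -> p = 0.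

(** By [mina], [chi] is the minimal polynomial of [a], so it divides every polynomial killing [a],
    in particular one with simple roots. *)
Lemma diag_inj : injective (fun i => a i i).
Proof.
have chi_dvd : chi %| rising_falling F n.+1 n.+1.
  set w := rising_falling F n.+1 n.+1.
  have w0 : horner_alg a w = 0.
    rewrite -(iterR1 rbR) -exprMn_comm.
      by rewrite (nilpotentR charF0 rbR size_chi chi_eq0) endo0E mul0rn.
    by apply: commrD => //; apply: commr1.
  apply/eqP; apply: mina.
    by rewrite -ltnS -size_chi ltn_modpN0 // -size_poly_eq0 size_chi.
  have -> : w %% chi = w - w %/ chi * chi.
    by rewrite [w in w - _](divp_eq w chi) addrC addKr.
  by rewrite rmorphB rmorphM /= w0 chi_eq0 mulr0 subr0.
have sepW : separable_poly (rising_falling F n.+1 n.+1).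
  by rewrite separable_prod_XsubC uniq_binomial_roots.
have := dvdp_separable chi_dvd sepW.
rewrite /chi -(big_map (fun i => a i i) xpredT (fun z => 'X - z%:P)).
rewrite separable_prod_XsubC /index_enum -enumT => uniq_a.
exact/injectiveP.
Qed.

Lemma nilpotentR_factors x :
  exists p : {poly F}, ((R * (R + 1)) ^+ n) x =
    ((R * (R + 1)) ^+ n) (horner_alg a p).
Proof.
have [p xp] := diag_interpolation diag_inj x; exists p.
apply/eqP; rewrite -subr_eq0 -linearB; apply/eqP.
apply: (strict_commutator_kernel diag_inj) xp => y.
exact: (nilpotentR_comm charF0 rbR y size_chi chi_eq0).
Qed.

Lemma nonderogatory_exponents :
  exists k j, [/\ (k + j = (2 * n.+1).-1)%N & R ^+ k * (R + 1) ^+ j = 0].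
Proof.
have [k [j [kj Q0]]] := cyclic_annihilator charF0 rbR size_chi chi_eq0 mina.
have cR : GRing.comm R (R + 1) by apply: commrD => //; apply: commr1.
have sE : (R * (R + 1)) ^+ n = R ^+ n * (R + 1) ^+ n.
  exact: exprMn_comm.
have cRX i m : R ^+ i * (R + 1) ^+ m = (R + 1) ^+ m * R ^+ i.
  exact/commrX/commr_sym/commrX/commr_sym.
(* A factor [s^n] replaces [x] by some [p(a)]; the same product, regrouped, then contains the factor
   [R^k (R + 1)^j] that kills [p(a)]. *)
have key k' j' : (n <= k')%N -> (n <= j')%N -> (k <= k')%N -> (j <= j')%N ->
    R ^+ k' * (R + 1) ^+ j' = 0.
  move=> nk nj kk jj; apply/endoP => x.
  have [p xp] := nilpotentR_factors x.
  have split i1 i2 : (i1 <= k')%N -> (i2 <= j')%N -> R ^+ k' * (R + 1) ^+ j' =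
      (R ^+ (k' - i1) * (R + 1) ^+ (j' - i2)) * (R ^+ i1 * (R + 1) ^+ i2).
    move=> le1 le2; rewrite -mulrA [_ ^+ (j' - i2) * _]mulrA -cRX.
    by rewrite !mulrA -exprD subnK // -mulrA -exprD subnK.
  rewrite (split n n) // endoME -sE xp sE -endoME -split // (split k j) //.
  by rewrite endoME Q0 linear0.
(* As [k + j = n + 1], the only case not covered by exponents [n + 1] and [n] is [j = n + 1],
   [k = 0]. *)
have [jn|jn] := leqP j n.
  exists n.+1, n; split; first by rewrite mul2n -addnn addSnnS.
  by apply: key => //; rewrite -kj leq_addr.
exists n, n.+1; split; first by rewrite mul2n -addnn.
apply: key => //; last by rewrite -kj leq_addl.
by rewrite -(leq_add2r j) kj -addn1 leq_add2l (leq_trans _ jn).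
Qed.

End Nonderogatory.

Lemma upper_exponents :
  exists k j, [/\ (k + j = (2 * n.+1).-1)%N & R ^+ k * (R + 1) ^+ j = 0].
Proof.
have [[p [p0 szp pa0]]|nop] := pselect (exists p : {poly F},
    [/\ p != 0, (size p <= n.+1)%N & horner_alg a p = 0]); last first.
  apply: nonderogatory_exponents => p szp pa0; apply: contrapT => /eqP p0.
  by apply: nop; exists p.
(* Here [s^n] is already zero, so the extra factor [R + 1] only adjusts the total exponent. *)
exists n, n.+1; split; first by rewrite mul2n -addnn.
have szpE : size p = (size p).-1.+1 by rewrite prednK // size_poly_gt0.
have le_n : ((size p).-1 <= n)%N by rewrite -ltnS -szpE.
have sp := nilpotentR charF0 rbR szpE pa0.
have sn i : ((size p).-1 <= i)%N -> (R * (R + 1)) ^+ i = 0.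
  by move=> le_i; rewrite -(subnK le_i) exprD sp mulr0.
have cR : GRing.comm R (R + 1) by apply: commrD => //; apply: commr1.
by rewrite exprSr mulrA -exprMn_comm // sn // mul0r.
Qed.

End UpperBound.

(** Dividing an operator of weight [c * lambda] by [c] gives one of weight [lambda], and the two
    products of iterates differ by a nonzero scalar. *)
Lemma rb_bound_scale (F : fieldType) (A : algType F) (lambda c : F) (m : nat) :
  c != 0 -> rb_bound A lambda m -> rb_bound A (c * lambda) m.
Proof.
move=> c0 bm R rbR.
have rb' : rota_baxter lambda (c^-1 \*: R).
  move=> x y /=; rewrite -scalerAl -scalerAr rbR; congr (_ *: _).
  rewrite -linearZ; congr (R _).
  by rewrite !scalerDr scalerA mulKf // scalerAl scalerAr.
have [k le_km R0] := bm _ rb'; exists k => // x.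
set d := c^-1 in R0; have d0 : d != 0 by rewrite invr_eq0.
have iterZ j (f : {linear A -> A}) y :
    iter j (fun z => d *: f z) y = d ^+ j *: iter j f y.
  elim: j y => [|j IH] y /=; first by rewrite scale1r.
  by rewrite IH linearZ scalerA exprS.
pose g : {linear A -> A} := R \+ (c * lambda) \*: idfun.
have gE y : iter (m - k) (fun z => (d \*: R) z + lambda *: z) y =
    d ^+ (m - k) *: iter (m - k) g y.
  rewrite -iterZ; apply: eq_iter => z /=.
  by rewrite scalerDr scalerA mulKf.
have iterRZ j e y : iter j R (e *: y) = e *: iter j R y.
  by elim: j => //= j ->; rewrite linearZ.
have /eqP := R0 x; rewrite gE iterZ iterRZ !scaler_eq0 !expf_eq0.
by rewrite (negPf d0) !andbF => /eqP.
Qed.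

Lemma utmx_rb_bound (F : fieldType) (n : nat) :
  [pchar F] =i pred0 -> rb_bound (utmx F n.+1) 1 (2 * n.+1 - 1).
Proof.
move=> charF0 R rbR; pose T := endo_of R.
have rbT x y : T x * T y = T (T x * y + x * T y + x * y).
  by rewrite /= rbR scale1r.
have [k [j [kj TR]]] := upper_exponents charF0 rbT.
rewrite subn1 -kj; exists k; first exact: leq_addr.
move=> x; rewrite addKn; have /endoP/(_ x) := TR.
rewrite endoME !endoXE endo0E => <-; congr (iter k R _).
by apply: eq_iter => y; rewrite scale1r.
Qed.

(** * An extremal operator *)

Section Extremal.
Variables (F : fieldType) (n : nat).
Local Notation A := (utmx F n.+1).
Implicit Types x y z : A.

(** Natural-number indices permit shifts along a diagonal; [inord] reads an index above [n] as
    [0]. *)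
Definition entry x (p q : nat) : F := x (inord p) (inord q).

Lemma entryE x (i j : 'I_n.+1) : entry x i j = x i j.
Proof. by rewrite /entry !inord_val. Qed.

Lemma entry_linear p q : scalar (fun x => entry x p q).
Proof. by move=> c x y; rewrite /entry utmxDE utmxZE. Qed.

Lemma entry_lt x p q : (p < n.+1)%N -> (q < p)%N -> entry x p q = 0.
Proof.
move=> pn qp; rewrite /entry utmx_lt // !inordK //.
exact: ltn_trans pn.
Qed.

Lemma entryM x y p q : (p <= q)%N -> (q < n.+1)%N ->
  entry (x * y) p q = \sum_(p <= r < q.+1) entry x p r * entry y r q.
Proof.
move=> pq qn; rewrite /entry utmxME.
transitivity (\sum_(0 <= r < n.+1) entry x p r * entry y r q).
  rewrite big_mkord; apply: eq_bigr => k _.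
  by rewrite /entry !inord_val.
rewrite (big_cat_nat (n := p)) //=; last by rewrite ltnW // (leq_ltn_trans pq).
rewrite big_nat big1 ?add0r => [|r /andP[_ rp]]; last first.
  by rewrite entry_lt ?mul0r // (leq_ltn_trans pq).
rewrite (big_cat_nat (n := q.+1)) //=; last by rewrite (leq_trans pq).
rewrite [X in _ + X]big_nat [X in _ + X]big1 ?addr0 // => r /andP[qr rn].
by rewrite [entry y r q]entry_lt ?mulr0.
Qed.

(* The index [q = n.+1] is allowed: it provides the boundary value [0] off the
   diagonal. *)
Definition sumdiag x (p q : nat) : F :=
  if p == q then \sum_(r < p) entry x r r
  else - \sum_(l < n.+1 - q) entry x (p + l) (q + l).

Lemma sumdiag_linear p q : scalar (fun x => sumdiag x p q).
Proof.
move=> c x y; rewrite /sumdiag; case: eqP => _.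
  rewrite mulr_sumr -big_split; apply: eq_bigr => r _; exact: entry_linear.
rewrite mulrN mulr_sumr -opprD -big_split; congr (- _).
by apply: eq_bigr => r _; apply: entry_linear.
Qed.

(** Prefix sums and negated suffix sums solve the same difference equation along a diagonal and
    differ only in where they vanish. *)
Lemma sumdiagS x p q : (q < n.+1)%N ->
  sumdiag x p.+1 q.+1 = sumdiag x p q + entry x p q.
Proof.
move=> qn; rewrite /sumdiag eqSS; case: eqP => [->|_].
  by rewrite big_ord_recr.
rewrite subnS; case E: (n.+1 - q)%N => [|d /=].
  by move/eqP: E; rewrite subn_eq0 leqNgt qn.
rewrite big_ord_recl !addn0 opprD addrC addrA subrr add0r; congr (- _).
by apply: eq_bigr => l _; rewrite !addSnnS.
Qed.

Lemma sumdiag00 x : sumdiag x 0 0 = 0.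
Proof. by rewrite /sumdiag eqxx big_ord0. Qed.

Lemma sumdiag_last x p : p != n.+1 -> sumdiag x p n.+1 = 0.
Proof. by move=> pn; rewrite /sumdiag (negPf pn) subnn big_ord0 oppr0. Qed.

Definition diagsum_mx x : 'M[F]_n.+1 :=
  \matrix_(i, j) if (i <= j)%N then sumdiag x i j else 0.

Lemma diagsum_mx_ut x : diagsum_mx x \in @is_utmx F n.+1.
Proof. by apply/is_utmxP => i j ji; rewrite mxE leqNgt ji. Qed.

Definition diagsum x : A := Utmx (diagsum_mx_ut x).

Lemma diagsum_linear : linear diagsum.
Proof.
move=> c x y; apply: utmxP => i j; rewrite utmxDE utmxZE !mxE.
by case: leqP => _; rewrite ?sumdiag_linear // mulr0 addr0.
Qed.

HB.instance Definition _ :=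
  GRing.isLinear.Build F A A *:%R diagsum diagsum_linear.

Lemma entry_diagsum x p q : (p <= q)%N -> (q < n.+1)%N ->
  entry (diagsum x) p q = sumdiag x p q.
Proof.
move=> pq qn; rewrite /entry mxE !inordK ?pq //; exact: leq_ltn_trans qn.
Qed.

Section Product.
Variables x y : A.
Let z := diagsum x * y + x * diagsum y + x * y.
Let w p q := \sum_(p <= r < q.+1) sumdiag x p r * sumdiag y r q.

(** With [w] the entries of [diagsum x * diagsum y], extended to the index [n.+1], expanding each
    shifted product term by term leaves exactly the entry of [z]. *)
Lemma entry_prodS p q : (p <= q)%N -> (q < n.+1)%N ->
  w p.+1 q.+1 = w p q + entry z p q.
Proof.
move=> pq qn; rewrite /w big_add1 /=.
have entryD u v : entry (u + v) p q = entry u p q + entry v p q.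
  by rewrite /entry utmxDE.
rewrite /z !entryD !entryM // -!big_split /= !big_nat.
apply: eq_bigr => r /andP[pr rq].
rewrite !sumdiagS // ?(leq_ltn_trans _ qn) //.
rewrite !entry_diagsum //; last by rewrite (leq_ltn_trans _ qn).
by rewrite mulrDl !mulrDr -!addrA; congr (_ + _); rewrite addrCA.
Qed.

(** Both sides solve the same difference equation and vanish at the boundary: at [(0, 0)] for the
    main diagonal, at [q = n.+1] for the others. The inductions run away from that boundary. *)
Lemma sumdiag_prod p q : (p <= q)%N -> (q <= n.+1)%N -> sumdiag z p q = w p q.
Proof.
move=> pq qn; have [<-|npq] := eqVneq p q.
  have : (p <= n.+1)%N by apply: leq_trans qn.
  elim: p {pq} => [|p IH] pn.
    by rewrite sumdiag00 /w big_nat1 sumdiag00 mul0r.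
  by rewrite sumdiagS // entry_prodS // IH // ltnW.
have {npq pq} lt_pq : (p < q)%N by rewrite ltn_neqAle npq.
have [d] := ubnP (n.+1 - q)%N; elim: d => // d IH in p q qn lt_pq *.
rewrite ltnS => le_d; have [q_last|q_lt] := leqP n.+1 q.
  have -> : q = n.+1 by apply/eqP; rewrite eqn_leq qn.
  have pn : p != n.+1 by rewrite neq_ltn (leq_trans lt_pq).
  rewrite sumdiag_last // /w big_nat_recr /=; last first.
    exact: leq_trans (ltnW lt_pq) qn.
  rewrite (sumdiag_last x pn) mul0r addr0 big_nat big1 // => r /andP[_ rn].
  by rewrite sumdiag_last ?mulr0 // neq_ltn rn.
have := IH p.+1 q.+1 q_lt lt_pq; rewrite subnS (sumdiagS _ _ q_lt).
rewrite entry_prodS // ?(ltnW lt_pq) // => E.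
apply: (addIr (entry z p q)); apply: E.
by rewrite prednK ?subn_gt0.
Qed.

End Product.

Lemma diagsum_rota_baxter : rota_baxter 1 diagsum.
Proof.
move=> x y; rewrite scale1r; apply: utmxP => i j.
have [lt_ji|le_ij] := ltnP j i; first by rewrite !utmx_lt.
rewrite -!entryE entry_diagsum ?sumdiag_prod ?entryM //; last exact: ltnW.
rewrite !big_nat; apply: eq_bigr => r /andP[ir rj].
by rewrite !entry_diagsum // (leq_ltn_trans _ (ltn_ord j)).
Qed.

Let diagsum1 x := diagsum x + 1 *: x.

Let entry_diagsum1 x p q : (p <= q)%N -> (q < n.+1)%N ->
  entry (diagsum1 x) p q = sumdiag x p.+1 q.+1.
Proof.
move=> pq qn; rewrite sumdiagS // -entry_diagsum // /diagsum1 scale1r.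
by rewrite /entry utmxDE.
Qed.

(** Follows the first nonzero diagonal entry: [diagsum1] keeps it at position [0], then each
    [diagsum] moves it one step down, and there are [n + 1] positions. *)
Lemma iter_diag_neq0 k j :
  (k <= n)%N -> iter k diagsum (iter j diagsum1 1) != 0.
Proof.
move=> kn; pose L p x := (forall r, (r < p)%N -> entry x r r = 0) /\
  entry x p p = 1.
suff [_ xk] : L k (iter k diagsum (iter j diagsum1 1)).
  apply: contraTneq (oner_neq0 F) => x0; rewrite -xk x0.
  by rewrite /entry utmx0E eqxx.
have sumL p x r : L p x -> (r <= p)%N -> sumdiag x r r = 0.
  move=> [x0 _] rp; rewrite /sumdiag eqxx big1 // => i _.
  by rewrite x0 // (leq_trans _ rp).
have L_diagsum p x : (p < n)%N -> L p x -> L p.+1 (diagsum x).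
  move=> pn Lx; split=> [r rp|].
    by rewrite entry_diagsum ?(sumL p) // (leq_trans rp) // ltnW.
  rewrite entry_diagsum // sumdiagS; last exact: ltnW.
  by rewrite (sumL p) // add0r; case: Lx.
have L_diagsum1 x : L 0%N x -> L 0%N (diagsum1 x).
  move=> [_ x1]; split=> //.
  by rewrite entry_diagsum1 // sumdiagS // sumdiag00 add0r.
elim: k kn => [_|k IH kn]; last by apply: L_diagsum => //; apply/IH/ltnW.
elim: j => [|j IH]; last exact: L_diagsum1.
by split=> //; rewrite /entry utmx1E eqxx.
Qed.

(** Follows the last nonzero entry of the first superdiagonal: [diagsum1] moves it one step up and
    [diagsum] fixes its position, out of [n] positions. *)
Lemma iter_superdiag_neq0 k j :
  (j < n)%N -> exists x, iter k diagsum (iter j diagsum1 x) != 0.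
Proof.
move=> jn; pose L p x := [/\ (p < n)%N,
  forall r, (p < r)%N -> (r < n)%N -> entry x r r.+1 = 0 & entry x p p.+1 != 0].
have sumL p x r : L p x -> (p < r)%N -> sumdiag x r r.+1 = 0.
  move=> [pn x0 _] pr; rewrite /sumdiag ltn_eqF // big1 ?oppr0 // => i _.
  rewrite addSn x0 ?(leq_trans pr) ?leq_addr // -ltn_subRL.
  exact: (ltn_ord i).
have L_diagsum p x : L p x -> L p (diagsum x).
  move=> Lx; have [pn _ xp] := Lx; split=> // [r pr rn|].
    by rewrite entry_diagsum ?(sumL p).
  rewrite entry_diagsum //; have := sumL _ _ p.+1 Lx (ltnSn _).
  by rewrite sumdiagS // => /eqP; rewrite addr_eq0 => /eqP ->; rewrite oppr_eq0.
have L_diagsum1 p x : L p.+1 x -> L p (diagsum1 x).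
  move=> Lx; have [pn _ xp] := Lx; split=> [|r pr rn|]; first exact: ltnW.
    by rewrite entry_diagsum1 ?(sumL p.+1).
  rewrite entry_diagsum1 ?(ltnW pn) //; last by rewrite ltnS ltnW.
  have := sumL _ _ p.+2 Lx (ltnSn _).
  by rewrite sumdiagS // => /eqP; rewrite addr_eq0 => /eqP ->; rewrite oppr_eq0.
(* Only the last superdiagonal entry of this start has to be nonzero. *)
pose J : 'M[F]_n.+1 := \matrix_(i, j) (i <= j)%:R.
have utJ : J \in @is_utmx F n.+1.
  by apply/is_utmxP => i i' lt; rewrite mxE leqNgt lt.
exists (Utmx utJ).
suff [pn _] : L (n.-1 - j)%N (iter k diagsum (iter j diagsum1 (Utmx utJ))).
  apply: contraNneq => ->; by rewrite /entry utmx0E.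
elim: k => [|k IH]; last exact: L_diagsum.
elim: j jn => [|j IH] jn /=.
  have n1 : n.-1.+1 = n by rewrite prednK // (leq_trans _ jn).
  rewrite subn0; split=> [|r rn nr|]; first by rewrite n1.
    by move: rn; rewrite n1 leqNgt nr.
  by rewrite /entry mxE !inordK ?n1 // ?leq_pred ?oner_eq0 // ltnW // n1.
have nj : (n.-1 - j.+1).+1 = (n.-1 - j)%N.
  by rewrite subnS prednK // subn_gt0 -ltnS prednK // (leq_trans _ jn).
by apply: L_diagsum1; rewrite nj; apply/IH/ltnW.
Qed.

(** The diagonal forces at least [n + 1] factors [R], the first superdiagonal at least [n] factors
    [R + 1]. *)
Lemma rb_bound_lower m : rb_bound A 1 m -> (2 * n.+1 - 1 <= m)%N.
Proof.
move=> /(_ _ diagsum_rota_baxter) [k le_km R0].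
have nk : (n < k)%N.
  by rewrite ltnNge; apply/negP => /(iter_diag_neq0 (m - k)); rewrite R0 eqxx.
have nmk : (n <= m - k)%N.
  rewrite leqNgt; apply/negP => /(iter_superdiag_neq0 k) [x].
  by rewrite R0 eqxx.
by rewrite subn1 mul2n -addnn /= -(subnK le_km) leq_add.
Qed.

End Extremal.

Theorem corollary5 (F : fieldType) (lambda : F) (n : nat)
    (charF0 : [pchar F] =i pred0) (lambda_neq0 : lambda != 0) :
  rb_index (utmx F n.+1) lambda = Some (2 * n.+1 - 1)%N.
Proof.
apply/rb_index_SomeP; split.
  by rewrite -[lambda]mulr1; apply/rb_bound_scale/utmx_rb_bound.
move=> m; rewrite -[lambda]mulr1 => bm; apply: (@rb_bound_lower F).
(* Scaling by the inverse of [lambda] carries the bound back to weight 1. *)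
rewrite -(mulVf lambda_neq0); apply: rb_bound_scale; rewrite ?invr_eq0 //.
by rewrite -[lambda]mulr1.
Qed.
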